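(* Let $n\ge2$ and suppose that $I\subset[n-1]$ has cardinality $n-2$. Then $\mathrm{ASM}^I(n)=S_n^I$ (with permutations identified with their permutation matrices).
   Context: $[m]=\{1,\dots,m\}$. An alternating sign matrix (ASM) is a square matrix with entries in $\{0,1,-1\}$ such that the nonzero entries in each row and each column alternate in sign and each row and each column sums to $1$; $\mathrm{ASM}(n)$ is the set of $n\times n$ ASMs. The rank matrix of $A$ is $r_A(i,j)=\sum_{p=1}^i\sum_{q=1}^jA_{p,q}$, with $r_A(0,j)=r_A(i,0)=0$. $\mathrm{ASM}^I(n):=\{A\in\mathrm{ASM}(n)\mid r_A(i,j)\in\{r_A(i-1,j)+1,\ r_A(i+1,j)\}\text{ for all }i\in I,\ j\in[n]\}$. $S_n^I=\{w\in S_n\mid w(i)<w(i+1)\text{ for all }i\in I\}$, where $w\in S_n$ is identified with the permutation matrix having $1$'s in positions $(i,w(i))$. *)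

(* Defs.v *)
From HB Require Import structures.
From mathcomp Require Import all_boot all_order all_algebra all_fingroup.

Set Implicit Arguments.
Unset Strict Implicit.
Unset Printing Implicit Defensive.

Import Order.TTheory GRing.Theory Num.Theory.
Local Open Scope ring_scope.

(* An ordinal k : 'I_m, whose value is in {0, ..., m - 1}, stands for the      *)
(* element k + 1 of [m] = {1, ..., m}.                                         *)

Definition alternating n (f : 'I_n -> int) : Prop :=
  forall p q : 'I_n, (p < q)%N -> f p != 0 -> f q != 0 ->
    (forall k : 'I_n, (p < k < q)%N -> f k = 0) -> f p * f q < 0.

Definition is_ASM n (A : 'M[int]_n) : Prop :=
  [/\ forall i j, A i j \in [:: 0; 1; -1],
      forall i, alternating (fun j => A i j),
      forall j, alternating (fun i => A i j),
      forall i, \sum_(j < n) A i j = 1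
    & forall j, \sum_(i < n) A i j = 1].

(* The arguments i and j are natural numbers with their 1-based meaning: the   *)
(* sum is over the first i rows and the first j columns.                       *)
Definition rank_fun n (A : 'M[int]_n) (i j : nat) : int :=
  \sum_(p < n | (p < i)%N) \sum_(q < n | (q < j)%N) A p q.

(* Here k and l stand for i = k + 1 in I and j = l + 1 in [n].                 *)
Definition in_ASM_I n (I : {set 'I_n.-1}) (A : 'M[int]_n) : Prop :=
  is_ASM A /\
  forall (k : 'I_n.-1) (l : 'I_n), k \in I ->
    rank_fun A k.+1 l.+1 \in [:: rank_fun A k l.+1 + 1; rank_fun A k.+2 l.+1].

(* Here p and q are the rows i and i + 1 for i = k + 1 in I.                   *)
Definition in_S_I n (I : {set 'I_n.-1}) (w : 'S_n) : Prop :=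
  forall (k : 'I_n.-1) (p q : 'I_n), k \in I ->
    p = k :> nat -> q = k.+1 :> nat -> (w p < w q)%N.

(* Main.v *)
Require Import Defs.
From mathcomp Require Import all_boot all_order all_algebra all_fingroup.
From mathcomp Require Import zify.

(* Write P_i(j) for the sum of the first j entries of row i of A; it lies in    *)
(* {0, 1}, as do the partial sums of the columns.  The rank condition at i says *)
(* that P_(i+1) <= P_i pointwise.  Let d be the only element of [n-1] outside   *)
(* I and suppose that A_(i,j) = -1, so that P_i(j-1) = 1 and P_i(j) = 0.  If    *)
(* i <= d, then P_p(j-1) = 1 for all p <= i, so A_(p,j) <= 0 for p <= i, and    *)
(* the partial sum of column j up to row i is negative.  If i > d, then         *)
(* P_p(j) = 0 for all p >= i, so A_(p,j) <= 0 for p >= i, and the partial sum   *)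
(* of column j before row i exceeds 1.  So A has no entry -1.                   *)

Set Implicit Arguments.
Unset Strict Implicit.
Unset Printing Implicit Defensive.

Import Order.TTheory GRing.Theory Num.Theory.
Local Open Scope ring_scope.

(** Once [entry_neqN1] has excluded the entry -1, [A] has entries 0 and 1 with all row and column
    sums 1, so it is a permutation matrix ([mx01_perm]). For the matrix of [w], P_i(j) is 1 or 0
    according to whether w(i) <= j ([psum_perm_mx]), so P_(i+1) <= P_i says exactly that w(i) <
    w(i+1). This gives the ascents of [w] as well as the converse inclusion. *)

Definition psum n (f : 'I_n -> int) (m : nat) : int := \sum_(q < n | (q < m)%N) f q.

Lemma psum0 n (f : 'I_n -> int) : psum f 0 = 0.
Proof. by rewrite /psum big_pred0. Qed.

Lemma psumS n (f : 'I_n -> int) (p : 'I_n) : psum f p.+1 = psum f p + f p.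
Proof.
rewrite /psum (bigD1 p) //= addrC; congr (_ + _); apply: eq_bigl => q.
by rewrite ltnS ltn_neqAle andbC.
Qed.

Lemma psum_split n (f : 'I_n -> int) m :
  \sum_(q < n) f q = psum f m + \sum_(q < n | (m <= q)%N) f q.
Proof.
rewrite (bigID (fun q : 'I_n => (q < m)%N)) /=; congr (_ + _).
by apply: eq_bigl => q; rewrite -leqNgt.
Qed.

Lemma rank_funS n (A : 'M[int]_n) (p : 'I_n) j :
  rank_fun A p.+1 j = rank_fun A p j + psum (A p) j.
Proof. exact: (psumS (fun p => psum (A p) j)). Qed.

Section Alternating.

Variables (n : nat) (f : 'I_n -> int).
Hypotheses (f_sign : forall i, f i \in [:: 0; 1; -1]) (f_alt : alternating f).

(* The second case records the last nonzero entry p before b, which makes the   *)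
(* induction on b go through.                                                   *)
Lemma alternating_interval_sum a b :
  let s := \sum_(k < n | (a <= k < b)%N) f k in
  (s = 0 /\ forall k : 'I_n, (a <= k < b)%N -> f k = 0) \/
  exists p : 'I_n, [/\ (p < b)%N, f p != 0,
    forall k : 'I_n, (p < k < b)%N -> f k = 0 & s = 0 \/ s = f p].
Proof.
move=> s; rewrite {}/s; elim: b => [|b IH].
  left; split; first by rewrite big_pred0 // => k; rewrite ltn0 andbF.
  by move=> k; rewrite ltn0 andbF.
have [nb|bn] := leqP n b.
  have E (k : 'I_n) c : (c <= k < b.+1)%N = (c <= k < b)%N.
    by have := ltn_ord k; lia.
  rewrite (eq_bigl (fun k : 'I_n => (a <= k < b)%N)); last by move=> k; exact: E.
  case: IH => [[s0 z]|[p [pb fp z s]]]; [left|right].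
    by split=> // k; rewrite E; exact: z.
  by exists p; split=> // [|k]; [exact: ltnW | rewrite E; exact: z].
have [ab|ba] := leqP a b; last first.
  left; split; first by rewrite big_pred0 // => k; lia.
  by move=> k; lia.
pose i := Ordinal bn.
have E : \sum_(k < n | (a <= k < b.+1)%N) f k =
    \sum_(k < n | (a <= k < b)%N) f k + f i.
  rewrite (bigD1 i) /=; last by rewrite ab ltnSn.
  rewrite addrC; congr (_ + _); apply: eq_bigl => k.
  by rewrite -val_eqE /=; lia.
have last_i c (k : 'I_n) : (c < k < b.+1)%N -> k = i \/ (c < k < b)%N.
  move=> h; have [kb|kb] := eqVneq (k : nat) b; first by left; apply: val_inj.
  by right; lia.
rewrite E; have [fi0|fi0] := eqVneq (f i) 0.
  rewrite fi0 addr0; case: IH => [[s0 z]|[p [pb fp z s]]]; [left|right].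
    split=> // k h; have [kb|kb] := eqVneq (k : nat) b.
      by rewrite (_ : k = i) //; apply: val_inj.
    by apply: z; lia.
  exists p; split=> // [|k /last_i[->|]//]; first exact: ltnW.
  exact: z.
right; exists i; split=> // [k|]; first by rewrite /=; lia.
case: IH => [[s0 _]|[p [pb fp z [s|s]]]]; first by right; rewrite s0 add0r.
  by right; rewrite s add0r.
(* The sum so far is [f p], and the next nonzero entry [f i] has the opposite sign: they cancel. *)
left; rewrite s; have := @f_alt p i pb fp fi0 z.
have := f_sign p; have := f_sign i; rewrite !inE.
by move=> /or3P[] /eqP -> /or3P[] /eqP ->.
Qed.

Lemma alternating_interval_sum_norm a b :
  `|\sum_(k < n | (a <= k < b)%N) f k| <= 1.
Proof.
case: (alternating_interval_sum a b) => [[-> _]|[p [_ _ _ [->|->]]]] //.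
by have := f_sign p; rewrite !inE => /or3P[] /eqP ->.
Qed.

(** Prefix and suffix both have absolute value at most 1 and add up to 1, so neither can be
    negative. *)
Lemma alternating_psum01 m : \sum_(k < n) f k = 1 -> 0 <= psum f m <= 1.
Proof.
rewrite (psum_split f m).
have := alternating_interval_sum_norm 0 m; rewrite -/(psum f m).
have := alternating_interval_sum_norm m n.
rewrite (eq_bigl (fun k : 'I_n => (m <= k)%N)) => [|k]; last first.
  by rewrite ltn_ord andbT.
move: (psum f m) (\sum_(k < n | _) _) => x y; lia.
Qed.

End Alternating.

Lemma sum1_unit_eq0 n (f : 'I_n -> int) i j :
  (forall k, 0 <= f k) -> \sum_(k < n) f k = 1 -> f i = 1 -> j != i -> f j = 0.
Proof.
move=> f0; rewrite (bigD1 i) //= => fs fi ji; move: fs; rewrite fi.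
move/(canRL (addKr 1)); rewrite addNr => /psumr_eq0P; exact.
Qed.

Lemma sum01_unit n (f : 'I_n -> int) :
  (forall k, f k \in [:: 0; 1]) -> \sum_(k < n) f k = 1 -> exists i, f i == 1.
Proof.
move=> f01 fs; apply/existsP; apply: contra_eqT fs => /existsPn f1.
rewrite big1 // => k _; have := f1 k; have := f01 k; rewrite !inE.
by case/orP=> /eqP ->.
Qed.

(** The permutation sends a row to the column of its 1; it is injective because a column with two
    1's would sum to more than 1. *)
Lemma mx01_perm n (A : 'M[int]_n) :
  (forall i j, A i j \in [:: 0; 1]) ->
  (forall i, \sum_(j < n) A i j = 1) -> (forall j, \sum_(i < n) A i j = 1) ->
  exists w : 'S_n, A = perm_mx w.
Proof.
move=> A01 rs cs.
have A_ge0 i j : 0 <= A i j.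
  by have := A01 i j; rewrite !inE => /orP[] /eqP ->.
have ex i : exists j, A i j == 1 by exact: sum01_unit (A01 i) (rs i).
pose w i := xchoose (ex i).
have Aw i : A i (w i) = 1 by apply/eqP; exact: xchooseP (ex i).
have w_inj : injective w.
  move=> i k wik; apply/eqP/negPn/negP => ik.
  have Ak : A k (w i) = 1 by rewrite wik Aw.
  have := sum1_unit_eq0 (f := A^~ (w i)) (A_ge0^~ _) (cs _) Ak ik.
  by rewrite Aw.
exists (perm w_inj); apply/matrixP => i j; rewrite !mxE permE.
have [<-|wj] := eqVneq (w i) j; first exact: Aw.
by rewrite (sum1_unit_eq0 (A_ge0 i) (rs i) (Aw i)) // eq_sym.
Qed.

Lemma psum_perm_mx n (w : 'S_n) p m : psum (perm_mx w p) m = (w p < m)%N%:R.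
Proof.
rewrite /psum (eq_bigr (fun q => (w p == q)%:R)) => [|q _]; last by rewrite !mxE.
have [wm|wm] := boolP (w p < m)%N.
  rewrite (bigD1 (w p)) //= eqxx big1 ?addr0 // => q /andP[_ qw].
  by rewrite eq_sym (negPf qw).
by rewrite big1 // => q qm; case: eqP wm => // ->; rewrite qm.
Qed.

(** Alternation is vacuous, as no line has two nonzero entries; column sums are row sums for the
    inverse permutation. *)
Lemma perm_mx_ASM n (w : 'S_n) : is_ASM (perm_mx w : 'M[int]_n).
Proof.
have sum1 (v : 'S_n) i : \sum_(j < n) (perm_mx v : 'M[int]_n) i j = 1.
  transitivity (psum (perm_mx v i) n); last by rewrite psum_perm_mx ltn_ord.
  by apply: eq_bigl => q; rewrite ltn_ord.
split=> [i j|i p q pq|j p q pq|i|j].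
- by rewrite !mxE; case: eqP.
- rewrite !mxE; case: (w i =P p) => // wp _; case: (w i =P q) => // wq.
  by rewrite -wp wq ltnn in pq.
- rewrite !mxE; case: (w p =P j) => // wp _; case: (w q =P j) => // wq.
  by rewrite (perm_inj (etrans wp (esym wq))) ltnn in pq.
- exact: sum1.
- rewrite -[RHS](sum1 w^-1%g j); apply: eq_bigr => i _.
  by rewrite -tr_perm_mx [RHS]mxE.
Qed.

(** Consecutive ranks in a fixed column differ by a row's partial sum. For partial sums in {0, 1}
    the right-hand side means [psum (A q) m <= psum (A p) m]. *)
Lemma rank_condP n (A : 'M[int]_n) (k : 'I_n.-1) (p q : 'I_n) m :
  p = k :> nat -> q = k.+1 :> nat ->
  (rank_fun A k.+1 m \in [:: rank_fun A k m + 1; rank_fun A k.+2 m]) =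
  (psum (A p) m == 1) || (psum (A q) m == 0).
Proof.
move=> pk qk; rewrite !inE -qk rank_funS qk -pk rank_funS.
rewrite (inj_eq (addrI _)) -[X in X == _ + _]addr0 (inj_eq (addrI _)).
by rewrite [0 == _]eq_sym.
Qed.

Section RowChain.

Variables (n : nat) (I : {set 'I_n.-1}) (A : 'M[int]_n).
Hypothesis A_in : in_ASM_I I A.

Lemma row_psum01 i m : 0 <= psum (A i) m <= 1.
Proof. by case: A_in => -[sg alt _ rs _] _; exact: alternating_psum01. Qed.

Lemma col_psum01 j m : 0 <= psum (A^~ j) m <= 1.
Proof. by case: A_in => -[sg _ alt _ cs] _; exact: alternating_psum01. Qed.

Lemma row_psum_step (k : 'I_n.-1) (p q : 'I_n) m :
  k \in I -> p = k :> nat -> q = k.+1 :> nat -> (m <= n)%N ->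
  psum (A q) m <= psum (A p) m.
Proof.
move=> kI pk qk; case: m => [|m] mn; first by rewrite !psum0.
have := (A_in.2 k (Ordinal mn) kI); rewrite (rank_condP _ _ pk qk) /=.
by have := row_psum01 p m.+1; have := row_psum01 q m.+1; lia.
Qed.

Lemma row_psum_chain (p q : 'I_n) m :
  (p <= q)%N -> (m <= n)%N -> (forall k : 'I_n.-1, (p <= k < q)%N -> k \in I) ->
  psum (A q) m <= psum (A p) m.
Proof.
move=> pq mn; case: q pq => q; rewrite /=; elim: q => [|q IH] qn pq kI.
  by rewrite (_ : p = Ordinal qn) //; apply: val_inj => /=; lia.
have [pq1|pq1] := eqVneq (p : nat) q.+1.
  by rewrite (_ : p = Ordinal qn) //; apply: val_inj.
have qn' : (q < n.-1)%N by lia.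
apply: le_trans (IH (ltnW qn) _ _); last by move=> k h; apply: kI; lia.
  by apply: (@row_psum_step (Ordinal qn')) => //; apply: kI => /=; lia.
by lia.
Qed.

Hypotheses (d : 'I_n.-1) (dI : forall k, k != d -> k \in I).

Lemma entry_neqN1 i j : A i j != -1.
Proof.
apply/eqP => Aij.
(* As [j] counts from 0, [psum (A i) j] and [psum (A i) j.+1] are the partial sums just before and
   just after the entry -1, so they are 1 and 0. *)
have Ei (p : 'I_n) : psum (A p) j.+1 = psum (A p) j + A p j := psumS _ _.
have jn := ltn_ord j.
have [id|di] := leqP i d.
  have col (p : 'I_n) : (p <= i)%N -> A p j <= 0.
    move=> pi; have := row_psum_chain (m := j) pi (ltnW jn).
    have := row_psum01 p j.+1; have := row_psum01 i j.+1.
    have := row_psum01 p j; rewrite !Ei Aij => h1 h2 h3 h.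
    suff: psum (A i) j <= psum (A p) j by lia.
    by apply: h => k h; apply: dI; apply: contraTneq h => ->; lia.
  have := col_psum01 j i.+1; rewrite psumS Aij.
  suff: psum (A^~ j) i <= 0 by lia.
  by apply: sumr_le0 => p pi; apply: col; exact: ltnW.
have col (p : 'I_n) : (i <= p)%N -> A p j <= 0.
  move=> ip; have := row_psum_chain (m := j.+1) ip jn.
  have := row_psum01 p j; have := row_psum01 i j.
  have := row_psum01 p j.+1; rewrite !Ei Aij => h1 h2 h3 h.
  suff: psum (A p) j + A p j <= psum (A i) j - 1 by lia.
  by apply: h => k h; apply: dI; apply: contraTneq h => ->; lia.
(* The column sums to 1, with -1 in row [i] and no positive entry below, so the part above row [i]
   is at least 2. *)
have := col_psum01 j i.
case: A_in => -[_ _ _ _ /(_ j)] + _; rewrite (psum_split _ i) (bigD1 i) //= Aij.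
suff: \sum_(p < n | (i <= p)%N && (p != i)) A p j <= 0.
  by move: (\sum_(p < n | _) _) (psum _ _) => x y; lia.
by apply: sumr_le0 => p /andP[ip _]; exact: col.
Qed.

End RowChain.

Theorem proposition4p2 (n : nat) (I : {set 'I_n.-1})
    (n_ge2 : (2 <= n)%N) (cardI : #|I| = (n - 2)%N) (A : 'M[int]_n) :
  in_ASM_I I A <-> exists2 w : 'S_n, in_S_I I w & A = perm_mx w.
Proof.
split=> [A_in|[w wI ->]]; last first.
  split=> [|k l kI]; first exact: perm_mx_ASM.
  have pn : (k < n)%N by have := ltn_ord k; lia.
  have qn : (k.+1 < n)%N by have := ltn_ord k; lia.
  rewrite (@rank_condP _ _ k (Ordinal pn) (Ordinal qn)) // !psum_perm_mx.
  have := wI k (Ordinal pn) (Ordinal qn) kI erefl erefl.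
  by lia.
(* The complement has (n - 1) - (n - 2) = 1 element. *)
have [d dE] : exists d, ~: I = [set d].
  by apply/cards1P; rewrite cardsCs setCK card_ord cardI; lia.
have dI k : k != d -> k \in I by rewrite -in_set1 -dE inE negbK.
have [sg _ _ rs cs] := A_in.1.
have [|w Aw] := mx01_perm (A := A) _ rs cs.
  move=> i j; have := entry_neqN1 A_in dI i j; have := sg i j.
  by rewrite !inE => /or3P[] /eqP ->.
exists w => // k p q kI pk qk.
(* At this [m] the partial sum of row [q] is already 1, hence so is that of row [p], that is,
   [w p <= w q]. *)
have := row_psum_step A_in (m := (w q).+1) kI pk qk (ltn_ord _).
rewrite Aw !psum_perm_mx.
have : w p != w q :> nat.
  by rewrite val_eqE (inj_eq perm_inj) -val_eqE /= pk qk neq_ltn ltnSn.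
by rewrite ltnSn; lia.
Qed.
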